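(* Let $r\ge 2$, $m\ge 1$, and consider a balanced (tenable) linear $r$-color urn model with multiple drawings and sample size $m$, under any of the four sampling schemes (unordered or ordered samples, drawn with or without replacement), with initial composition $\mathbf{X}_0$. Then for all $n\ge 0$ the expected value $\boldsymbol{\mu}_n=\mathbb{E}[\mathbf{X}_n]$ is given by \[ \boldsymbol{\mu}_n=\mathbf{X}_0\Big(I+\frac{1}{T_0}A\Big)\cdots\Big(I+\frac{1}{T_{n-1}}A\Big), \] where $I$ is the $r\times r$ identity matrix and $A$ denotes the reduced ball replacement matrix of the linear model.
   Context: Vectors are row vectors; $\mathbf{e}_i$ is the $i$-th unit vector of $\mathbb{R}^r$. Let $\Delta=\{\mathbf{k}=(k_1,\dots,k_r)\in\mathbb{Z}^r : k_i\ge 0,\ \sum_{i=1}^r k_i=m\}$ and $\mathcal{S}=\{\mathbf{d}=(d_1,\dots,d_m): 1\le d_i\le r,\ 1\le i\le m\}$. For $\mathbf{d}\in\mathcal{S}$ let $\mathbf{j}(\mathbf{d})=(j_1(\mathbf{d}),\dots,j_r(\mathbf{d}))\in\Delta$ with $j_\ell(\mathbf{d})=\#\{i: d_i=\ell\}$. For a color $i$, $i\cdot\boldsymbol{1}=(i,\dots,i)\in\mathcal{S}$ is the constant sequence of length $m$. Write $x^{\underline{k}}=x(x-1)\cdots(x-k+1)$ and $\binom{m}{\mathbf{k}}=\frac{m!}{k_1!\cdots k_r!}$; also $0^0=1$. Urn model. The urn contains balls of $r$ colors. The composition after $n$ draws is $\mathbf{X}_n=(X_n^{(1)},\dots,X_n^{(r)})$,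 where $X_n^{(i)}$ is the number of balls of color $i$; the initial composition $\mathbf{X}_0$ is a non-random vector of nonnegative integers, and $T_n=\sum_{i=1}^r X_n^{(i)}$. At each step $n\ge 1$ a sample of $m$ balls is drawn, its colors are observed, the sample is returned to the urn, and a vector in $\mathbb{Z}^r$ depending on the sample is added to $\mathbf{X}_{n-1}$ to give $\mathbf{X}_n$. $\mathcal{F}_n$ is the sigma-algebra generated by the first $n$ draws. Unordered samples: the replacement matrix is $M=(\mathbf{a}_{\mathbf{k}})_{\mathbf{k}\in\Delta}$ and $\mathbf{a}_{\mathbf{k}}$ is added if the sample contains exactly $k_i$ balls of color $i$ for each $i$; conditionally on $\mathcal{F}_{n-1}$ this has probability $\binom{m}{\mathbf{k}}\prod_i (X_{n-1}^{(i)})^{\underline{k_i}}/(T_{n-1})^{\underline{m}}$ in model $\mathcal{M}$ (without replacement) and $\binom{m}{\mathbf{k}}\prod_i (X_{n-1}^{(i)})^{k_i}/(T_{n-1})^{m}$ in model $\mathcal{R}$ (with replacement). Ordered samples: the replacement matrix is $M=(\mathbf{a}_{\mathbf{d}})_{\mathbf{d}\in\mathcal{S}}$ and $\mathbf{a}_{\mathbf{d}}$ is added if the sequence of observed colors is $\mathbf{d}$; conditionally on $\mathcal{F}_{n-1}$ this has probability $\prod_\ell (X_{n-1}^{(\ell)})^{\underline{j_\ell(\mathbf{d})}}/(T_{n-1})^{\underline{m}}$ in model $\mathcal{M}_{SEQ}$ (without replacement) and $\prod_\ell (X_{n-1}^{(\ell)})^{j_\ell(\mathbf{d})}/(T_{n-1})^{m}$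 in model $\mathcal{R}_{SEQ}$ (with replacement). Balanced: there is a constant integer $\sigma>0$ such that the entries of every row of $M$ sum to $\sigma$. Hence $T_n=n\sigma+T_0$ is deterministic. Tenability (standing assumption). For a row $(a_1,\dots,a_r)$ of $M$ with index $\mathbf{k}$ (or index $\mathbf{d}$ with $\mathbf{k}=\mathbf{j}(\mathbf{d})$): without replacement, $a_i\ge -k_i$ for all $i$; with replacement, $a_i\ge -1$ if $k_i>0$ and $a_i\ge 0$ if $k_i=0$. The initial total satisfies $T_0\ge m$ (without replacement) or $T_0\ge 1$ (with replacement) so that sampling is possible; such totals $T_0$ are called admissible. Linear: an urn model (given by $M$ and the sampling scheme) is called linear if for every admissible total $T_0$ there exist real $r\times r$ matrices $(C_n)_{n\ge 1}$, not depending on the composition of the urn, such that for every initial composition $\mathbf{X}_0$ with total $T_0$ one has $\mathbb{E}[\mathbf{X}_n\mid\mathcal{F}_{n-1}]=\mathbf{X}_{n-1}\cdot C_n$ for all $n\ge 1$. Reduced ball replacement matrix $A$: the $r\times r$ matrix whose $i$-th row ($1\le i\le r$) is $\mathbf{a}_{m\cdot\mathbf{e}_i}$ for unordered samples, and $\mathbf{a}_{i\cdot\boldsymbol{1}}$ for ordered samples. For $n=0$ the matrix product in the claim is empty (equal to $I$). *)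

(* Defs.v *)
From HB Require Import structures.
From mathcomp Require Import all_boot all_order all_algebra.
From mathcomp Require Import all_classical all_reals all_analysis.

Set Implicit Arguments.
Unset Strict Implicit.
Unset Printing Implicit Defensive.

Import Order.TTheory GRing.Theory Num.Theory.
Import numFieldNormedType.Exports.

Local Open Scope classical_set_scope.
Local Open Scope ring_scope.

(* The bound m on each entry is implied by the sum condition; it is there only
   to make the index set a finite type. *)
Definition Delta (r m : nat) : finType :=
  {k : {ffun 'I_r -> 'I_m.+1} | (\sum_(l < r) k l == m)%N}.

Lemma mono_sum (r m : nat) (i : 'I_r) :
  (\sum_(l < r) [ffun l => if l == i then ord_max else ord0 : 'I_m.+1] l
     == m)%N.
Proof.
rewrite (bigD1 i) //= ffunE eqxx big1 ?addn0 // => l /negPf li.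
by rewrite ffunE li.
Qed.

(* The element m e_i of Delta. *)
Definition mono_unordered (r m : nat) (i : 'I_r) : Delta r m :=
  exist _ [ffun l => if l == i then ord_max else ord0 : 'I_m.+1]
    (mono_sum m i).

Inductive scheme := ModelM | ModelR | ModelMSEQ | ModelRSEQ.

Definition with_replacement (s : scheme) : bool :=
  match s with
  | ModelM | ModelMSEQ => false
  | ModelR | ModelRSEQ => true
  end.

Definition sample (s : scheme) (r m : nat) : finType :=
  match s with
  | ModelM | ModelR => Delta r m
  | ModelMSEQ | ModelRSEQ => m.-tuple 'I_r
  end.

(* counts k l = k_l for unordered samples; counts d l = j_l(d) for ordered
   ones. *)
Definition counts (s : scheme) (r m : nat) : sample s r m -> 'I_r -> nat :=
  match s return sample s r m -> 'I_r -> nat with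
  | ModelM | ModelR => fun k l => val k l
  | ModelMSEQ | ModelRSEQ => fun d l => count_mem l d
  end.

(* The sample all of whose m balls have color i. *)
Definition mono_sample (s : scheme) (r m : nat) (i : 'I_r) : sample s r m :=
  match s return sample s r m with
  | ModelM | ModelR => mono_unordered m i
  | ModelMSEQ | ModelRSEQ => [tuple of nseq m i]
  end.

Definition num_balls (r : nat) (x : 'rV[int]_r) : int := \sum_(l < r) x 0 l.

Definition falling (R : pzRingType) (x : R) (k : nat) : R :=
  \prod_(i < k) (x - i%:R).

Definition multinomial (R : realType) (r m : nat) (k : 'I_r -> nat) : R :=
  m`!%:R / \prod_(l < r) (k l)`!%:R.

(* One-step probability of observing the sample j from an urn with composition
   x. *)
Definition draw_prob (R : realType) (s : scheme) (r m : nat)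
    (x : 'rV[int]_r) (j : sample s r m) : R :=
  let k := counts j in
  let t : R := (num_balls x)%:~R in
  let y (l : 'I_r) : R := (x 0 l)%:~R in
  match s with
  | ModelM => multinomial R m k * (\prod_(l < r) falling (y l) (k l))
                / falling t m
  | ModelR => multinomial R m k * (\prod_(l < r) y l ^+ k l) / t ^+ m
  | ModelMSEQ => (\prod_(l < r) falling (y l) (k l)) / falling t m
  | ModelRSEQ => (\prod_(l < r) y l ^+ k l) / t ^+ m
  end.

Definition balanced (s : scheme) (r m : nat) (M : sample s r m -> 'rV[int]_r)
    (sigma : int) : Prop :=
  0 < sigma /\ forall j, num_balls (M j) = sigma.

Definition tenable (s : scheme) (r m : nat) (M : sample s r m -> 'rV[int]_r)
    : Prop :=
  forall (j : sample s r m) (i : 'I_r),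
    if with_replacement s
    then (if (0 < counts j i)%N then -1 <= M j 0 i else 0 <= M j 0 i)
    else - (counts j i)%:Z <= M j 0 i.

Definition admissible_total (s : scheme) (m : nat) (T0 : int) : Prop :=
  if with_replacement s then 1 <= T0 else m%:Z <= T0.

Definition initial_composition (r : nat) (x : 'rV[int]_r) : Prop :=
  forall i, 0 <= x 0 i.

(* Z is a version of the conditional expectation of Y given the
   sub-sigma-algebra F. *)
Definition is_cond_exp (R : realType) (d : measure_display)
    (Omega : measurableType d) (P : probability Omega R)
    (F : set (set Omega)) (Y Z : Omega -> R) : Prop :=
  [/\ P.-integrable setT (EFin \o Y),
      P.-integrable setT (EFin \o Z),
      (forall B : set R, measurable B -> F (Z @^-1` B)) &
      (forall A : set Omega, F A ->
         (\int[P]_(w in A) (Z w)%:E = \int[P]_(w in A) (Y w)%:E)%E)].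

(* In what follows D n w is the sample observed at the (n+1)-st draw. *)

Fixpoint composition (s : scheme) (r m : nat) (M : sample s r m -> 'rV[int]_r)
    (X0 : 'rV[int]_r) (Omega : Type) (D : nat -> Omega -> sample s r m)
    (n : nat) (w : Omega) : 'rV[int]_r :=
  if n is p.+1 then composition M X0 D p w + M (D p w) else X0.

(* The sigma-algebra generated by the first n draws. *)
Definition history (Omega : Type) (S : Type) (D : nat -> Omega -> S) (n : nat)
    : set (set Omega) :=
  <<s [set A | exists k j, (k < n)%N /\ A = D k @^-1` [set j]] >>.

Definition urn_process (R : realType) (s : scheme) (r m : nat)
    (M : sample s r m -> 'rV[int]_r) (X0 : 'rV[int]_r)
    (d : measure_display) (Omega : measurableType d) (P : probability Omega R)
    (D : nat -> Omega -> sample s r m) : Prop :=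
  (forall n j, measurable (D n @^-1` [set j])) /\
  (forall n j,
     is_cond_exp P (history D n) (\1_(D n @^-1` [set j]))
       (fun w => draw_prob R (composition M X0 D n w) j)).

Definition linear_urn (R : realType) (s : scheme) (r m : nat)
    (M : sample s r m -> 'rV[int]_r) : Prop :=
  forall T0 : int, admissible_total s m T0 ->
  exists C : nat -> 'M[R]_r,
  forall X0 : 'rV[int]_r, initial_composition X0 -> num_balls X0 = T0 ->
  forall (d : measure_display) (Omega : measurableType d)
    (P : probability Omega R) (D : nat -> Omega -> sample s r m),
    urn_process M X0 P D ->
  forall n : nat, (1 <= n)%N -> forall i : 'I_r,
    is_cond_exp P (history D n.-1)
      (fun w => (composition M X0 D n w 0 i)%:~R)
      (fun w => (map_mx intr (composition M X0 D n.-1 w) *m C n) 0 i).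

Definition reduced_matrix (R : realType) (s : scheme) (r m : nat)
    (M : sample s r m -> 'rV[int]_r) : 'M[R]_r :=
  \matrix_(i < r, l < r) (M (mono_sample s m i) 0 l)%:~R.

(* The (deterministic) total T_n of a balanced urn, justified by
   num_balls_composition. *)
Definition urn_total (R : realType) (sigma T0 : int) (n : nat) : R :=
  (n%:Z * sigma + T0)%:~R.

Lemma num_balls_composition (R : realType) (s : scheme) (r m : nat)
    (M : sample s r m -> 'rV[int]_r) (sigma : int) (X0 : 'rV[int]_r)
    (Omega : Type) (D : nat -> Omega -> sample s r m) (n : nat) (w : Omega) :
  balanced M sigma ->
  (num_balls (composition M X0 D n w))%:~R = urn_total R sigma (num_balls X0) n.
Proof.
move=> [_ bal]; rewrite /urn_total; congr (_%:~R).
elim: n => [|n IHn] /=; first by rewrite mul0r add0r.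
have -> : num_balls (composition M X0 D n w + M (D n w))
    = num_balls (composition M X0 D n w) + num_balls (M (D n w)).
  by rewrite /num_balls -big_split; apply: eq_bigr => l _; rewrite mxE.
by rewrite IHn bal -addn1 PoszD mulrDl mul1r addrAC.
Qed.

(* Main.v *)
(* Linearity is only used for the first step, but at every total T: it gives a
   matrix C with E[X_1] = X_0 C for all X_0 of total T.  For X_0 = T e_i the
   sample is monochromatic, so T e_i C = T e_i + A_i, that is, C = I + A/T.
   Hence the one-step mean from any composition x of total T is x (I + A/T).
   For the given urn this applies at time n with x = X_n and T = T_n, because
   with probability 1 the composition X_n is nonnegative with admissible total,
   and averaging over the finitely many histories gives
   mu_(n+1) = mu_n (I + A/T_n).

   Linearity quantifies over urn processes, so a process started from a
   prescribed composition has to be exhibited; it lives on [0, 1[ with the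
   uniform law. *)

Require Import Defs.
From HB Require Import structures.
From mathcomp Require Import all_boot all_order all_algebra.
From mathcomp Require Import all_classical all_reals all_analysis.

Set Implicit Arguments.
Unset Strict Implicit.
Unset Printing Implicit Defensive.

Import Order.TTheory GRing.Theory Num.Theory.
Import numFieldNormedType.Exports.

Local Open Scope classical_set_scope.
Local Open Scope ring_scope.

(** * Color sequences, factorial powers and multinomial counting *)

Lemma sum_count_mem (T : finType) (d : seq T) :
  (\sum_(l : T) count_mem l d)%N = size d.
Proof.
elim: d => [|x d IHd] /=; first by rewrite big1.
rewrite big_split /= IHd (bigD1 x) //= eqxx big1 // => l /negPf.
by rewrite eq_sym => ->.
Qed.

Lemma big_tuple_cons (R : Type) (idx : R) (op : Monoid.com_law idx)
    (T : finType) (m : nat) (F : m.+1.-tuple T -> R) :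
  \big[op/idx]_t F t =
  \big[op/idx]_(x : T) \big[op/idx]_(t : m.-tuple T) F (cons_tuple x t).
Proof.
rewrite pair_big /= (reindex (fun p : T * m.-tuple T => cons_tuple p.1 p.2)) //.
exists (fun t => (thead t, [tuple of behead t])) => [[x t] _|t _] /=.
  by congr (_, _); apply: val_inj.
by rewrite [RHS]tuple_eta; apply: val_inj.
Qed.

(* Falling factorial power for [b = true], ordinary power for [b = false], so
   that the two kinds of sampling share one computation. *)
Definition gen_power (R : pzRingType) (b : bool) (x : R) (k : nat) : R :=
  \prod_(i < k) (x - (b * i)%:R).

Lemma gen_powerS (R : pzRingType) (b : bool) (x : R) (k : nat) :
  gen_power b x k.+1 = gen_power b x k * (x - (b * k)%:R).
Proof. by rewrite /gen_power big_ord_recr. Qed.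

Lemma gen_power0 (R : pzRingType) (b : bool) (x : R) : gen_power b x 0 = 1.
Proof. by rewrite /gen_power big_ord0. Qed.

Lemma gen_power_falling (R : pzRingType) (x : R) (k : nat) :
  gen_power true x k = falling x k.
Proof. by apply: eq_bigr => i _; rewrite mul1n. Qed.

Lemma gen_power_exp (R : pzRingType) (x : R) (k : nat) :
  gen_power false x k = x ^+ k.
Proof.
rewrite /gen_power (eq_bigr (fun=> x)) ?prodr_const ?card_ord // => i _.
by rewrite mul0n subr0.
Qed.

Lemma gen_power_nat (R : realType) (b : bool) (y k : nat) :
  gen_power b (y%:R : R) k = (if b then y ^_ k else y ^ k)%N%:R.
Proof.
case: b; last by rewrite gen_power_exp natrX.
elim: k => [|k IHk]; first by rewrite gen_power0.
rewrite gen_powerS IHk ffactnSr mul1n natrM.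
have [kley|ylek] := leqP k y; first by rewrite natrB.
by rewrite ffact_small // !mul0r.
Qed.

(** A falling factorial of a nonnegative integer reaches the factor 0 before any negative one. *)
Lemma gen_power_int_ge0 (R : realType) (b : bool) (y : int) (k : nat) :
  0 <= y -> 0 <= gen_power b (y%:~R : R) k.
Proof. by case: y => // y _; rewrite -pmulrn gen_power_nat ler0n. Qed.

(** Turns a nonzero draw probability into a lower bound on the number of balls of a color. The guard
    [0 < k] reflects the convention 0^0 = 1. *)
Lemma gen_power_int_neq0 (R : realType) (b : bool) (y : int) (k : nat) :
  0 <= y -> (gen_power b (y%:~R : R) k != 0) =
            (if b then k%:Z <= y else (0 < k)%N ==> (1 <= y)).
Proof.
case: y => // y _; rewrite -pmulrn gen_power_nat pnatr_eq0.
case: b; first by rewrite -lt0n ffact_gt0.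
by rewrite -lt0n expn_gt0; case: k => [|k]; rewrite ?orbT ?orbF.
Qed.

(* Appending a ball of color i multiplies the product by [y i - b * j_i(d)],
   and these factors sum to [T - b * m]. *)
Lemma sum_gen_power_count (R : comPzRingType) (b : bool) (r m : nat)
    (y : 'I_r -> R) :
  \sum_(d : m.-tuple 'I_r) \prod_(l < r) gen_power b (y l) (count_mem l d) =
  gen_power b (\sum_(l < r) y l) m.
Proof.
elim: m => [|m IHm].
  rewrite gen_power0 (big_pred1 [tuple]) => [|t]; last exact/esym/eqP/tuple0.
  by rewrite big1 // => l _; rewrite gen_power0.
rewrite big_tuple_cons exchange_big gen_powerS -IHm /= big_distrl /=.
apply: eq_bigr => d _.
have consE i : \prod_(l < r) gen_power b (y l) ((i == l) + count_mem l d) =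
    (\prod_(l < r) gen_power b (y l) (count_mem l d)) *
    (y i - (b * count_mem i d)%:R).
  rewrite (bigD1 i) //= [in RHS](bigD1 i) //= eqxx add1n gen_powerS.
  rewrite -!mulrA; congr (_ * _); rewrite mulrC; congr (_ * _).
  by apply: eq_bigr => l /negPf li; rewrite eq_sym li.
rewrite (eq_bigr _ (fun i _ => consE i)) -big_distrr /= sumrB.
congr (_ * (_ - _)); rewrite -natr_sum -big_distrr /=; congr (_ * _)%:R.
by rewrite sum_count_mem size_tuple.
Qed.

(** Sequences are split by the color i of their first ball, and the factor m + 1 of (m + 1)! is
    split as the sum of the [k i]; the two sums then agree color by color. *)
Lemma card_tuple_count (r m : nat) (k : 'I_r -> nat) :
  (\sum_(l < r) k l = m)%N ->
  (#|[pred d : m.-tuple 'I_r | [forall l, count_mem l d == k l]]| *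
     \prod_(l < r) (k l)`! = m`!)%N.
Proof.
elim: m k => [|m IHm] k sumk.
  have k0 l : k l = 0%N.
    by apply/eqP; rewrite -leqn0 -sumk (bigD1 l) //= leq_addr.
  rewrite big1 ?muln1 => [|l _]; last by rewrite k0.
  rewrite -sum1_card (big_pred1 [tuple]) // => t.
  transitivity true; last exact/esym/eqP/tuple0.
  by rewrite inE; apply/forallP => l; rewrite k0 (tuple0 t).
rewrite -sum1_card big_mkcond big_tuple_cons /= big_distrl /=.
rewrite factS -[in RHS]sumk big_distrl /=; apply: eq_bigr => i _.
case ki: (k i) => [|p].
  rewrite big1 ?mul0n // => d _; case: ifPn => //= /forallP/(_ i) /=.
  by rewrite eqxx ki.
(* Counts left for the remaining m balls. The lost unit supplies the factor [k i] = p + 1 of the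
   i-th term. *)
pose k' l := if l == i then p else k l.
have sumk' : (\sum_(l < r) k' l = m)%N.
  move: sumk; rewrite (bigD1 i) //= ki addSn => -[<-].
  rewrite (bigD1 i) //= /k' eqxx; congr addn.
  by apply: eq_bigr => l /negPf ->.
rewrite -(IHm k' sumk') -sum1_card [in RHS]big_mkcond /= mulnCA mulnC.
rewrite [in RHS]mulnC; congr (_ * _)%N; last first.
  apply: eq_bigr => d _; congr (if _ then _ else _).
  rewrite !inE; apply: eq_forallb => l; rewrite /k' /= [i == l]eq_sym.
  by case: (l =P i) => [->|_] //; rewrite ki.
rewrite (bigD1 i) //= [in RHS](bigD1 i) //= ki factS /k' eqxx -mulnA.
by congr (_ * (_ * _))%N; apply: eq_bigr => l /negPf ->.
Qed.

Lemma card_tuple_multinomial (R : realType) (r m : nat) (k : 'I_r -> nat) :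
  (\sum_(l < r) k l = m)%N ->
  #|[pred d : m.-tuple 'I_r | [forall l, count_mem l d == k l]]|%:R =
  multinomial R m k.
Proof.
move=> /card_tuple_count card_k; rewrite /multinomial -card_k natrM natr_prod mulfK //.
by apply/prodf_neq0 => l _; rewrite pnatr_eq0 -lt0n fact_gt0.
Qed.

Lemma counts_sum (s : scheme) (r m : nat) (j : sample s r m) :
  (\sum_(l < r) counts j l = m)%N.
Proof.
have seqE (d : m.-tuple 'I_r) : (\sum_(l < r) count_mem l d = m)%N.
  by rewrite sum_count_mem size_tuple.
by case: s j => j; [exact/eqP/(valP j) | exact/eqP/(valP j) | exact: seqE ..].
Qed.

(** The number of color sequences that give one sample; with it a single formula covers all four
    schemes. *)
Definition sample_weight (R : realType) (s : scheme) (r m : nat)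
    (k : 'I_r -> nat) : R :=
  match s with
  | ModelM | ModelR => multinomial R m k
  | ModelMSEQ | ModelRSEQ => 1
  end.

(* An unordered sample k arises from multinomial(m, k) ordered ones, so every
   sum over samples is a sum over color sequences. *)
Lemma sum_sample_counts (R : realType) (s : scheme) (r m : nat)
    (F : 'I_r -> nat -> R) :
  \sum_(j : sample s r m)
     sample_weight R s m (counts j) * \prod_(l < r) F l (counts j l) =
  \sum_(d : m.-tuple 'I_r) \prod_(l < r) F l (count_mem l d).
Proof.
have unordered : \sum_(k : Delta r m) multinomial R m (@counts ModelM r m k) *
      \prod_(l < r) F l (@counts ModelM r m k l) =
    \sum_(d : m.-tuple 'I_r) \prod_(l < r) F l (count_mem l d).
  have cntP (d : m.-tuple 'I_r) (l : 'I_r) : (count_mem l d < m.+1)%N.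
    by rewrite ltnS -[leqRHS](size_tuple d) count_size.
  pose cnt d : {ffun 'I_r -> 'I_m.+1} := [ffun l => Ordinal (cntP d l)].
  have sumP d : (\sum_(l < r) cnt d l == m)%N.
    under eq_bigr do rewrite ffunE.
    by rewrite /= (@counts_sum ModelMSEQ).
  (* [K] forgets the order of the balls. Its fibers have multinomial size and the summand is
     constant on each of them. *)
  pose K d : Delta r m := exist _ (cnt d) (sumP d).
  rewrite (partition_big K xpredT) //=; apply: eq_bigr => k _.
  rewrite -card_tuple_multinomial; last exact: (@counts_sum ModelM _ _ k).
  rewrite -sum1_card natr_sum big_distrl /=.
  have KE d : (K d == k) = [forall l, count_mem l d == val k l].
    apply/eqP/forallP => [<- l|kd]; first by rewrite ffunE.
    by apply/val_inj/ffunP => l; apply: val_inj; rewrite ffunE /= (eqP (kd l)).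
  apply: eq_big => [d|d]; rewrite inE ?KE // => /forallP kd; rewrite mul1r.
  by apply: eq_bigr => l _; rewrite (eqP (kd l)).
by case: s => //=; apply: eq_bigr => d _; rewrite mul1r.
Qed.

(** * One-step draw probabilities *)

Section DrawProbability.
Variables (R : realType) (s : scheme) (r m : nat).
Implicit Types (x : 'rV[int]_r) (j : sample s r m).

Local Notation wor := (~~ with_replacement s).

(** The invariant under which [draw_prob] is a probability distribution. *)
Definition composition_ok x : Prop :=
  initial_composition x /\ admissible_total s m (num_balls x).

Lemma draw_probE x j :
  draw_prob R x j =
  sample_weight R s m (counts j) *
    (\prod_(l < r) gen_power wor ((x 0 l)%:~R : R) (counts j l)) /
  gen_power wor ((num_balls x)%:~R : R) m.
Proof.
rewrite /draw_prob /sample_weight; case: s j => j /=;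
  rewrite ?gen_power_falling ?gen_power_exp ?mul1r;
  congr (_ / _); try congr (_ * _); apply: eq_bigr => l _;
  by rewrite ?gen_power_falling ?gen_power_exp.
Qed.

Lemma sample_weight_ge0 (k : 'I_r -> nat) : 0 <= sample_weight R s m k.
Proof.
have mult_ge0 : 0 <= multinomial R m k.
  by rewrite divr_ge0 ?ler0n // prodr_ge0 // => l _; rewrite ler0n.
by rewrite /sample_weight; case: s.
Qed.

Lemma num_balls_ge0 x : initial_composition x -> 0 <= num_balls x.
Proof. by move=> x_ge0; apply: sumr_ge0 => l _; apply: x_ge0. Qed.

Lemma draw_prob_ge0 x j : initial_composition x -> 0 <= draw_prob R x j.
Proof.
move=> x_ge0; rewrite draw_probE divr_ge0 ?mulr_ge0 ?sample_weight_ge0 //.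
  by apply: prodr_ge0 => l _; apply: gen_power_int_ge0.
by apply/gen_power_int_ge0/num_balls_ge0.
Qed.

Lemma admissible_gen_power_neq0 (t : int) :
  admissible_total s m t -> gen_power wor (t%:~R : R) m != 0.
Proof.
rewrite /admissible_total => adm; rewrite gen_power_int_neq0.
  by case: with_replacement adm => //= ->; rewrite implybT.
by move: adm; case: with_replacement; apply: le_trans.
Qed.

Lemma sum_draw_prob x : composition_ok x -> \sum_(j : sample s r m) draw_prob R x j = 1.
Proof.
move=> [x_ge0 adm]; rewrite (eq_bigr _ (fun j _ => draw_probE x j)).
rewrite -big_distrl /=.
rewrite (sum_sample_counts s m (fun l => gen_power wor (x 0 l)%:~R)) sum_gen_power_count.
have -> : \sum_(l < r) (x 0 l)%:~R = (num_balls x)%:~R :> R.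
  by rewrite rmorph_sum.
by rewrite divff // admissible_gen_power_neq0.
Qed.

Lemma num_ballsD x y : num_balls (x + y) = num_balls x + num_balls y.
Proof.
by rewrite /num_balls -big_split; apply: eq_bigr => l _; rewrite mxE.
Qed.

(** A sample of nonzero probability has a nonzero factor for every color, so the urn holds enough
    balls to absorb the largest removal that tenability permits. The total only grows, since sigma
    is positive. *)
Lemma composition_ok_step (M : sample s r m -> 'rV[int]_r) (sigma : int) x j :
  balanced M sigma -> tenable M -> composition_ok x ->
  draw_prob R x j != 0 -> composition_ok (x + M j).
Proof.
move=> [sigma_gt0 bal] ten [x_ge0 adm].
rewrite draw_probE !mulf_eq0 => /norP[/norP[_ /prodf_neq0 cnt] _].
split=> [i|]; last first.
  rewrite num_ballsD bal /admissible_total; move: adm.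
  by rewrite /admissible_total; case: with_replacement => adm;
    rewrite (le_trans adm) // lerDl ltW.
move: (cnt i isT) (ten j i); rewrite gen_power_int_neq0 // mxE.
case: with_replacement => /=; last first.
  by move=> le_kx le_Mk; rewrite (le_trans _ (lerD le_kx le_Mk)) // subrr.
case: ltnP => /= [_ x1 M1|_ _ M0]; last by rewrite addr_ge0.
by rewrite (le_trans _ (lerD x1 M1)).
Qed.

Lemma counts_mono_sample (i l : 'I_r) :
  counts (mono_sample s m i) l = if l == i then m else 0%N.
Proof.
by case: s => /=; rewrite ?ffunE ?count_nseq /= ?[i == l]eq_sym;
  case: eqP => //= _; rewrite ?mul1n.
Qed.

Lemma num_balls_mono (t : int) (i : 'I_r) : num_balls (t *: delta_mx 0 i) = t.
Proof.
rewrite /num_balls (bigD1 i) //= big1 => [|l /negPf li]; rewrite !mxE !eqxx.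
  by rewrite addr0 mulr1.
by rewrite li mulr0.
Qed.

(** The weight is 1 and only color i contributes to the product, with a factor equal to the
    denominator. *)
Lemma draw_prob_mono (t : int) (i : 'I_r) : admissible_total s m t ->
  draw_prob R (t *: delta_mx 0 i) (mono_sample s m i) = 1.
Proof.
move=> adm; rewrite draw_probE num_balls_mono.
have -> : sample_weight R s m (counts (mono_sample s m i)) = 1.
  have -> : counts (mono_sample s m i) = fun l => if l == i then m else 0%N.
    by apply/funext => l; rewrite counts_mono_sample.
  have mult1 : multinomial R m (fun l => if l == i then m else 0%N) = 1.
    rewrite /multinomial (bigD1 i) //= eqxx big1 ?mulr1 => [|l /negPf -> //].
    by rewrite divff // pnatr_eq0 -lt0n fact_gt0.
  by rewrite /sample_weight mult1; case: s.
rewrite mul1r (bigD1 i) //= big1 => [|l /negPf li]; last first.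
  by rewrite counts_mono_sample li gen_power0.
rewrite counts_mono_sample eqxx mulr1 !mxE !eqxx mulr1.
by rewrite divff // admissible_gen_power_neq0.
Qed.

Lemma composition_ok_mono (t : int) (i : 'I_r) :
  admissible_total s m t -> composition_ok (t *: delta_mx 0 i).
Proof.
move=> adm; split; last by rewrite num_balls_mono.
move=> l; rewrite !mxE mulr_ge0 // ?ler0n //; move: adm.
by rewrite /admissible_total; case: with_replacement; apply: le_trans.
Qed.

End DrawProbability.

(** * A process with prescribed transition probabilities, built on the unit interval *)

Definition unit_uniform (R : realType) : set (measurableTypeR R) -> \bar R :=
  mrestr lebesgue_measure (measurable_itv `[(0 : R), 1[).

HB.instance Definition _ (R : realType) := Measure.on (@unit_uniform R).

Lemma unit_uniform_setT (R : realType) : @unit_uniform R setT = 1%E.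
Proof.
by rewrite /unit_uniform /mrestr setTI lebesgue_measure_itv /= lte_fin ltr01
  -EFinD subr0.
Qed.

HB.instance Definition _ (R : realType) :=
  @Measure_isProbability.Build _ _ R (@unit_uniform R) (@unit_uniform_setT R).

Lemma unit_uniform_itv (R : realType) (A : set R) (a b : R) :
  0 <= a -> a <= b -> b <= 1 -> A `&` [set` `[0, 1[] = [set` `[a, b[] ->
  unit_uniform A = (b - a)%:E.
Proof.
move=> a0 ab b1 AE; rewrite /unit_uniform /mrestr AE lebesgue_measure_itv /=.
rewrite lte_fin -EFinD; case: ltP => // ba.
by have -> : a = b by [apply/eqP; rewrite eq_le ab]; rewrite subrr.
Qed.

(* The first n draws, the most recent one first. *)
Fixpoint past (Omega : Type) (S : Type) (D : nat -> Omega -> S) (n : nat)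
    (w : Omega) : n.-tuple S :=
  if n is p.+1 then cons_tuple (D p w) (past D p w) else [tuple].

(* Every history h (most recent draw first) gets a subinterval of [0, 1[ of
   length its probability, the interval of h being cut into those of the j :: h
   according to q h; the process reads its draws off a uniform point. *)
Section IntervalProcess.
Variables (R : realType) (S : finType) (j0 : S) (q : seq S -> S -> R).
Hypotheses (q_ge0 : forall h j, 0 <= q h j)
           (q_sum1 : forall h, \sum_j q h j = 1).
Implicit Types (h : seq S) (j : S) (w : R).

(** The relative cut points of the cell of h, with the draws ordered by their rank in [S]. *)
Definition cumul h (k : nat) : R := \sum_(i : S | (enum_rank i < k)%N) q h i.

Lemma cumulS h j : cumul h (enum_rank j).+1 = cumul h (enum_rank j) + q h j.
Proof.
rewrite /cumul (bigD1 j) //= addrC; congr (_ + _); apply: eq_bigl => i.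
by rewrite ltnS ltn_neqAle andbC -(inj_eq enum_rank_inj).
Qed.

Lemma cumul_le h : {homo cumul h : k l / (k <= l)%N >-> k <= l}.
Proof.
move=> k l kl; rewrite /cumul [leRHS](bigID (fun i => (enum_rank i < k)%N)) /=.
rewrite [X in X + _](eq_bigl (fun i => (enum_rank i < k)%N)) => [|i].
  by rewrite lerDl sumr_ge0.
by case: (ltnP (enum_rank i) k) => [ik|]; rewrite ?andbF ?(leq_trans ik).
Qed.

Lemma cumul_card h : cumul h #|S| = 1.
Proof. by rewrite -(q_sum1 h); apply: eq_bigl => i; rewrite ltn_ord. Qed.

Lemma cumul0 h : cumul h 0 = 0.
Proof. by rewrite /cumul big_pred0. Qed.

Fixpoint cell_len h : R := if h is j :: h' then cell_len h' * q h' j else 1.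

Fixpoint cell_lo h : R :=
  if h is j :: h' then cell_lo h' + cell_len h' * cumul h' (enum_rank j) else 0.

Definition cell_hi h := cell_lo h + cell_len h.

Definition in_cell h w := (cell_lo h <= w) && (w < cell_hi h).

Lemma cell_len_ge0 h : 0 <= cell_len h.
Proof. by elim: h => [|j h IHh] //=; rewrite mulr_ge0. Qed.

Lemma cell_hi_cons j h :
  cell_hi (j :: h) = cell_lo h + cell_len h * cumul h (enum_rank j).+1.
Proof. by rewrite /cell_hi /= cumulS mulrDr addrA. Qed.

Lemma cell_lo_le j h : cell_lo h <= cell_lo (j :: h).
Proof. by rewrite /= lerDl mulr_ge0 ?cell_len_ge0 ?sumr_ge0. Qed.

Lemma cell_hi_le j h : cell_hi (j :: h) <= cell_hi h.
Proof.
rewrite cell_hi_cons lerD2l -[leRHS]mulr1 ler_wpM2l ?cell_len_ge0 //.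
by rewrite -(cumul_card h) cumul_le.
Qed.

Lemma cell_itv h : (0 <= cell_lo h) && (cell_hi h <= 1).
Proof.
elim: h => [|j h /andP[lo0 hi1]]; first by rewrite /cell_hi /= add0r !lexx.
by rewrite (le_trans lo0 (cell_lo_le _ _)) (le_trans (cell_hi_le _ _) hi1).
Qed.

Lemma in_cell_cons j h w : in_cell (j :: h) w -> in_cell h w.
Proof.
case/andP=> lo hi; apply/andP; split; first exact: le_trans (cell_lo_le _ _) lo.
exact: lt_le_trans hi (cell_hi_le _ _).
Qed.

(** Of two distinct draws, the one of smaller rank has its half-open cell end no later than the
    other begins. *)
Lemma in_cell_inj i j h w : in_cell (i :: h) w -> in_cell (j :: h) w -> i = j.
Proof.
have lt_rank (k l : S) : in_cell (k :: h) w -> in_cell (l :: h) w ->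
    ~~ (enum_rank k < enum_rank l)%N.
  move=> /andP[_ +] /andP[+ _]; rewrite cell_hi_cons => whi lo.
  apply/negP => kl; suff: w < w by rewrite ltxx.
  apply: lt_le_trans whi (le_trans _ lo).
  by rewrite /= lerD2l ler_wpM2l ?cell_len_ge0 ?cumul_le.
move=> wi wj; apply/enum_rank_inj/val_inj/eqP.
by rewrite eqn_leq leqNgt lt_rank //= leqNgt lt_rank.
Qed.

Lemma in_cell_cover h w : in_cell h w -> exists j, in_cell (j :: h) w.
Proof.
case/andP=> lo hi.
pose P k := w < cell_lo h + cell_len h * cumul h k.
have exP : exists k, P k by exists #|S|; rewrite /P cumul_card mulr1.
(* The first cut point above w is not the one of index 0, which is the lower end of the cell; its
   predecessor is the rank of the draw. *)
case: (ex_minnP exP) => -[|k] Pk mink.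
  by move: Pk; rewrite /P cumul0 mulr0 addr0 ltNge lo.
have kS : (k < #|S|)%N.
  by apply: mink; rewrite /P cumul_card mulr1.
exists (enum_val (Ordinal kS)).
rewrite /in_cell cell_hi_cons /= enum_valK; apply/andP; split=> //.
rewrite leNgt; by apply/negP => /mink; rewrite ltnn.
Qed.

(** The default [j0] occurs only for w outside the cell of h, in particular outside [0, 1[. *)
Definition next h w : S := odflt j0 [pick j | in_cell (j :: h) w].

Lemma nextP h w j : in_cell h w -> (next h w == j) = in_cell (j :: h) w.
Proof.
move=> /in_cell_cover[i wi]; rewrite /next; case: pickP => [k wk|/(_ i)].
  by apply/eqP/idP => [<- //|]; apply: in_cell_inj.
by rewrite wi.
Qed.

Fixpoint walk n w : seq S :=
  if n is p.+1 then next (walk p w) w :: walk p w else [::].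

Definition interval_process n w : S := next (walk n w) w.

Lemma walkE n w : past interval_process n w = walk n w :> seq S.
Proof. by elim: n => //= n ->. Qed.

(** Cells of a given history length partition [0, 1[, and the walk follows the one containing w. *)
Lemma walkP n w h : in_cell [::] w -> size h = n ->
  (walk n w == h) = in_cell h w.
Proof.
move=> w01; elim: n h => [[]|n IHn [//|j h] [szh]] //=; rewrite eqseq_cons.
have [wh|wh] := boolP (in_cell h w).
  have /eqP -> : walk n w == h by rewrite IHn.
  by rewrite eqxx andbT nextP.
rewrite [X in _ && X]IHn // (negPf wh) andbF; apply/esym/negP.
by move=> /in_cell_cons; apply/negP.
Qed.

Lemma measurable_in_cell h : measurable [set w | in_cell h w].
Proof.
rewrite (_ : [set w | _] = [set` `[cell_lo h, cell_hi h[]); first exact: measurable_itv.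
by apply/seteqP; split => w; rewrite /= in_itv.
Qed.

Lemma measurable_next h j : measurable [set w | next h w = j].
Proof.
(* Either the search finds j, or it finds nothing and j is the default. *)
have -> : [set w | next h w = j] = [set w | in_cell (j :: h) w] `|`
    (if j == j0 then ~` \bigcup_(i in [set: S]) [set w | in_cell (i :: h) w]
     else set0).
  apply/seteqP; split => w /=; rewrite /next; case: pickP => [i wi|no] /=.
  - by move=> <-; left.
  - by move=> <-; right; rewrite eqxx => -[i _] /=; rewrite no.
  - case=> [wj|]; first exact: in_cell_inj wi wj.
    by case: eqP => // _ []; exists i.
  - by rewrite no; case=> //; case: eqP.
apply: measurableU; first exact: measurable_in_cell.
case: ifP => // _; apply: measurableC; apply: fin_bigcup_measurable => // i _.
exact: measurable_in_cell.
Qed.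

Lemma measurable_walk n h : measurable [set w | walk n w = h].
Proof.
elim: n h => [|n IHn] [|j h] /=.
- by rewrite (_ : [set _ | _] = setT) //; apply/seteqP; split.
- by rewrite (_ : [set _ | _] = set0) //; apply/seteqP; split.
- by rewrite (_ : [set _ | _] = set0) //; apply/seteqP; split.
rewrite (_ : [set _ | _] = [set w | walk n w = h] `&` [set w | next h w = j]).
  exact: measurableI (IHn h) (measurable_next _ _).
by apply/seteqP; split => w /= => [[<- <-]|[<- <-]].
Qed.

Lemma measurable_interval_process n j :
  measurable (interval_process n @^-1` [set j]).
Proof.
rewrite (_ : _ @^-1` _ = \bigcup_(h in [set: n.-tuple S])
   ([set w | walk n w = h] `&` [set w | next h w = j])).
  apply: fin_bigcup_measurable => // h _.
  exact: measurableI (measurable_walk _ _) (measurable_next _ _).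
apply/seteqP; split => w /=; rewrite /interval_process.
  by move=> nextj; exists (past interval_process n w); rewrite //= walkE.
by move=> [h _ [/= -> ]].
Qed.

(** Within [0, 1[ the event is exactly the cell of h. *)
Lemma interval_process_law n (h : n.-tuple S) :
  unit_uniform [set w | past interval_process n w = h] = (cell_len h)%:E.
Proof.
have /andP[lo0 hi1] := cell_itv h.
have -> : cell_len h = cell_hi h - cell_lo h by rewrite /cell_hi addrC addKr.
apply: unit_uniform_itv => //; first by rewrite lerDl cell_len_ge0.
have cell0 w : in_cell [::] w = (0 <= w < 1) by rewrite /in_cell /cell_hi /= add0r.
apply/seteqP; split => w; rewrite /= !in_itv /= -cell0.
  move=> [<- w01]; rewrite -[_ && _]/(in_cell _ w) -(@walkP n) ?size_tuple //.
  by rewrite walkE.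
move=> wh; have w01 : in_cell [::] w.
  rewrite cell0; case/andP: wh => lo hi.
  by rewrite (le_trans lo0 lo) (lt_le_trans hi hi1).
split=> //; apply: val_inj; rewrite /= walkE; apply/eqP.
by rewrite walkP ?size_tuple.
Qed.

End IntervalProcess.

(** The finite-state case of the Ionescu-Tulcea theorem: the cell of j :: h has the length of the
    cell of h times [q h j]. *)
Lemma exists_process (R : realType) (S : finType) (q : seq S -> S -> R) :
  (forall h j, 0 <= q h j) -> (forall h, \sum_j q h j = 1) ->
  exists (P : probability (measurableTypeR R) R) (D : nat -> R -> S),
    (forall n j, measurable (D n @^-1` [set j] : set (measurableTypeR R))) /\
    forall n (h : n.-tuple S) j,
      P [set w | past D n.+1 w = cons_tuple j h] =
      ((q h j)%:E * P [set w | past D n w = h])%E.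
Proof.
move=> q_ge0 q_sum1.
(* Probabilities that sum to 1 force [S] to be nonempty. *)
have [j0 _] : exists j0 : S, true.
  apply/existsP; apply: contraT => /existsPn noS.
  by have := q_sum1 [::]; rewrite big1 ?(rwP eqP) 1?eq_sym ?oner_eq0 // => j; have := noS j.
exists (@unit_uniform R), (interval_process j0 q); split => [n j|n h j].
  exact: measurable_interval_process.
have law k := @interval_process_law _ _ j0 _ q_ge0 q_sum1 k.
by rewrite [LHS](law n.+1) [X in (_ * X)%E](law n) -EFinM mulrC.
Qed.

(** * Integrals of finite-valued functions and events of the history *)

Section FiniteValued.
Context d (Omega : measurableType d) (R : realType) (P : probability Omega R).
Variables (F : finType) (T : Omega -> F).
Hypothesis mT : forall f, measurable (T @^-1` [set f]).

Lemma finite_valued_indic (g : F -> R) w :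
  (g (T w))%:E = (\sum_(f : F) (g f)%:E * (\1_(T @^-1` [set f]) w)%:E)%E.
Proof.
rewrite (bigD1 (T w)) //= indicE mem_set // mule1 big1 ?adde0 // => f /eqP fT.
by rewrite indicE memNset ?mule0 // => /= Tf; apply: fT.
Qed.

Lemma integrable_term (g : F -> R) f :
  P.-integrable setT (fun w => (g f)%:E * (\1_(T @^-1` [set f]) w)%:E)%E.
Proof. exact/integrableZl/integrable_indic. Qed.

Lemma integrable_finite_valued (g : F -> R) :
  P.-integrable setT (EFin \o (fun w => g (T w))).
Proof.
rewrite (_ : _ \o _ = fun w =>
    (\sum_(f : F) (g f)%:E * (\1_(T @^-1` [set f]) w)%:E)%E).
  by apply: integrable_sum => // f _; exact: integrable_term.
by apply/funext => w; exact: finite_valued_indic.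
Qed.

Lemma integral_finite_valued (g : F -> R) :
  (\int[P]_w (g (T w))%:E = \sum_(f : F) (g f)%:E * P (T @^-1` [set f]))%E.
Proof.
under eq_integral do rewrite finite_valued_indic.
rewrite integral_sum //; last by move=> f; exact: integrable_term.
apply: eq_bigr => f _; rewrite integralZl //; last exact: integrable_indic.
by rewrite integral_indic // setIT.
Qed.

Lemma integral_preimage_finite_valued (H : set F) (g : F -> R) :
  (\int[P]_(w in T @^-1` H) (g (T w))%:E =
   \sum_(f in H) (g f)%:E * P (T @^-1` [set f]))%E.
Proof.
rewrite integral_mkcond [RHS]big_mkcond /=.
transitivity (\int[P]_w ((if T w \in H then g (T w) else 0)%:E))%E.
  apply: eq_integral => w _; rewrite patchE.
  rewrite (_ : (w \in T @^-1` H) = (T w \in H)); first by case: ifP.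
  by apply/idP/idP; rewrite !inE.
rewrite (integral_finite_valued (fun f => if f \in H then g f else 0)).
by apply: eq_bigr => f _; case: ifP => // _; rewrite mul0e.
Qed.

End FiniteValued.

(** Only the draws before time n are assumed measurable, so that the lemma also applies in the
    sigma-algebra generated by these draws. *)
Lemma measurable_past e (Omega : measurableType e) (S : finType)
    (D : nat -> Omega -> S) (n : nat) (h : n.-tuple S) :
  (forall k j, (k < n)%N -> measurable (D k @^-1` [set j])) ->
  measurable (past D n @^-1` [set h]).
Proof.
elim: n h => [|n IHn] h mD.
  rewrite (_ : _ @^-1` _ = setT) //; apply/seteqP; split=> // w _ /=.
  by rewrite [RHS]tuple0.
rewrite (_ : _ @^-1` _ = D n @^-1` [set thead h] `&`
    past D n @^-1` [set [tuple of behead h]]).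
  apply: measurableI; first exact: mD.
  by apply: IHn => k j kn; apply/mD/ltnW.
apply/seteqP; split => w /=.
  by move=> <-; rewrite theadE; split=> //; exact: val_inj.
by case=> Dw pw; rewrite [RHS]tuple_eta Dw pw; exact: val_inj.
Qed.

Lemma past_draw (Omega : Type) (S : Type) (D : nat -> Omega -> S) (n k : nat) :
  (k < n)%N -> exists phi : n.-tuple S -> S, forall w, D k w = phi (past D n w).
Proof.
elim: n => // n IHn; rewrite ltnS leq_eqVlt => /predU1P[->|/IHn[phi phiE]].
  by exists (fun h : n.+1.-tuple S => thead h) => w; rewrite /= theadE.
exists (fun h : n.+1.-tuple S => phi [tuple of behead h]) => w; rewrite phiE; congr phi.
exact: val_inj.
Qed.

(** Preimages under [past D n] form a sigma-algebra containing the generators; conversely, each is a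
    finite union of events fixing the first n draws. *)
Lemma historyP d (Omega : measurableType d) (S : finType)
    (D : nat -> Omega -> S) (n : nat) (A : set Omega) :
  history D n A <-> exists H : set (n.-tuple S), A = past D n @^-1` H.
Proof.
split=> [|[H ->]].
  move: A; apply: smallest_sub; first split.
  - by exists set0; rewrite preimage_set0.
  - by move=> _ [H ->]; exists (~` H); rewrite setTD preimage_setC.
  - move=> A /choice[H AE]; exists (\bigcup_k H k).
    by rewrite preimage_bigcup; apply: eq_bigcup.
  move=> _ [k [j [kn ->]]]; have [phi phiE] := past_draw D kn.
  exists (phi @^-1` [set j]); apply/seteqP.
  by split=> w /=; rewrite phiE.
rewrite (_ : _ @^-1` _ = \bigcup_(h in H) past D n @^-1` [set h]); last first.
  by apply/seteqP; split => w /= => [Hw|[h Hh -> //]]; exists (past D n w).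
pose G := [set A | exists k j, (k < n)%N /\ A = D k @^-1` [set j]].
apply: (@fin_bigcup_measurable _ (g_sigma_algebraType G)) => // h _.
apply: (@measurable_past _ (g_sigma_algebraType G)) => k j kn.
by apply: sub_sigma_algebra; exists k, j.
Qed.

(** * The urn process described by the probabilities of its histories *)

Section UrnLaw.
Variables (R : realType) (s : scheme) (r m : nat).
Variables (M : sample s r m -> 'rV[int]_r) (X0 : 'rV[int]_r).
Context d (Omega : measurableType d) (P : probability Omega R).
Variable D : nat -> Omega -> sample s r m.

Definition composition_after (h : seq (sample s r m)) : 'rV[int]_r :=
  foldr (fun j x => x + M j) X0 h.

Lemma composition_past n w :
  composition M X0 D n w = composition_after (past D n w).
Proof. by elim: n => //= n ->. Qed.

(** The conditional law of a draw in product form, which stays meaningful after histories of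
    probability 0. *)
Definition urn_law : Prop := forall n (h : n.-tuple (sample s r m)) j,
  P (past D n.+1 @^-1` [set cons_tuple j h]) =
  ((draw_prob R (composition_after h) j)%:E * P (past D n @^-1` [set h]))%E.

Hypothesis mD : forall n j, measurable (D n @^-1` [set j]).

Let mpast n (h : n.-tuple _) : measurable (past D n @^-1` [set h]).
Proof. by apply: measurable_past => k j _. Qed.

Lemma past_cons n (h : n.-tuple _) j :
  past D n.+1 @^-1` [set cons_tuple j h] =
  D n @^-1` [set j] `&` past D n @^-1` [set h].
Proof.
apply/seteqP; split => w /= => [[Dw pw]|[-> ->]] //.
by split=> //; exact: val_inj.
Qed.

(** The conditional expectation is tested on the event that the past is h, where the draw
    probability is constant. *)
Lemma urn_process_law : urn_process M X0 P D -> urn_law.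
Proof.
case=> _ cond n h j; have [_ _ _ /(_ (past D n @^-1` [set h]))] := cond n j.
rewrite integral_indic // -past_cons => <-; last by apply/historyP; exists [set h].
rewrite (eq_integral (fun=> (draw_prob R (composition_after h) j)%:E)).
  by rewrite integral_cst.
by move=> w; rewrite inE /= => pw; rewrite composition_past pw.
Qed.

Lemma urn_law_process : urn_law -> urn_process M X0 P D.
Proof.
move=> law; split=> // n j; set Z := fun w => _.
have ZE : Z = fun w => draw_prob R (composition_after (past D n w)) j.
  by apply/funext => w; rewrite /Z composition_past.
split.
- exact: integrable_indic.
- rewrite ZE; exact: (integrable_finite_valued P (@mpast n)
    (fun h : n.-tuple _ => draw_prob R (composition_after h) j)).
- move=> B _; apply/historyP.
  exists [set h : n.-tuple _ | B (draw_prob R (composition_after h) j)].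
  by rewrite ZE.
move=> _ /historyP[H ->]; rewrite ZE.
rewrite (integral_preimage_finite_valued P (@mpast n) H
  (fun h : n.-tuple _ => draw_prob R (composition_after h) j)).
(* The indicator of draw j after a past in [H], as a function of n + 1 draws; both integrals become
   finite sums over histories. *)
pose g (t : n.+1.-tuple (sample s r m)) : R :=
  ((thead t == j) && ([tuple of behead t] \in H))%:R.
have gE i (h : n.-tuple _) : g (cons_tuple i h) = ((i == j) && (h \in H))%:R.
  by rewrite /g theadE (_ : [tuple of _] = h) //; exact: val_inj.
rewrite integral_mkcond; transitivity (\int[P]_w (g (past D n.+1 w))%:E)%E.
  rewrite (integral_finite_valued P (@mpast n.+1)) big_tuple_cons /=.
  rewrite (bigD1 j) //= [X in (_ + X)%E]big1 ?adde0; last first.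
    move=> i /negPf ij; rewrite big1 // => h _.
    by rewrite gE ij mul0e.
  rewrite big_mkcond; apply: eq_bigr => h _; rewrite law gE eqxx /=.
  by case: ifP; rewrite ?mul1e ?mul0e.
apply: eq_integral => w _; rewrite patchE [past D n.+1 w]/(cons_tuple _ _) gE.
rewrite (_ : (w \in past D n @^-1` H) = (past D n w \in H)); last first.
  by apply/idP/idP; rewrite !inE.
rewrite indicE (_ : (w \in D n @^-1` [set j]) = (D n w == j)).
  by case: ifP; rewrite ?andbT ?andbF.
by apply/idP/eqP; rewrite inE.
Qed.

End UrnLaw.

(** * Linear urns: the one-step mean and its iteration *)

Section LinearUrn.
Variables (R : realType) (s : scheme) (r m : nat).
Variables (M : sample s r m -> 'rV[int]_r) (sigma : int).
Hypotheses (r_gt0 : (0 < r)%N) (m_gt0 : (0 < m)%N).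
Hypotheses (Mbal : balanced M sigma) (Mten : tenable M).

Local Notation p := (draw_prob R).

(* Stated for a kernel q that agrees with the urn only after admissible
   histories, since [exists_urn] has to modify it elsewhere. *)
Lemma reachable_ok (X0 : 'rV[int]_r) d (Omega : measurableType d)
    (P : probability Omega R) (D : nat -> Omega -> sample s r m)
    (q : seq (sample s r m) -> sample s r m -> R) :
  composition_ok s m X0 ->
  (forall h j, composition_ok s m (composition_after M X0 h) ->
     q h j = p (composition_after M X0 h) j) ->
  (forall n (h : n.-tuple (sample s r m)) j,
     P (past D n.+1 @^-1` [set cons_tuple j h]) =
     ((q h j)%:E * P (past D n @^-1` [set h]))%E) ->
  forall n (h : n.-tuple (sample s r m)), P (past D n @^-1` [set h]) != 0%E ->
  composition_ok s m (composition_after M X0 h).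
Proof.
move=> ok0 qE law; elim=> [|n IHn] h; first by rewrite (tuple0 h).
case/tupleP: h => j h; rewrite law mule_eq0 => /norP[+ /IHn okh].
by rewrite eqe qE // => pj; apply: (composition_ok_step Mbal Mten okh pj).
Qed.

Lemma exists_urn (x : 'rV[int]_r) : composition_ok s m x ->
  exists (P : probability (measurableTypeR R) R)
         (D : nat -> measurableTypeR R -> sample s r m), urn_process M x P D.
Proof.
move=> okx; pose j0 := mono_sample s m (Ordinal r_gt0).
(* After an inadmissible composition the draw probabilities need not form a distribution, so a point
   mass replaces them. By [reachable_ok] this affects only histories of probability 0. *)
pose q h j := if `[< composition_ok s m (composition_after M x h) >]
  then p (composition_after M x h) j else (j == j0)%:R.
have q_ge0 h j : 0 <= q h j.
  by rewrite /q; case: asboolP => [[? _]|_]; rewrite ?ler0n ?draw_prob_ge0.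
have q_sum1 h : \sum_j q h j = 1.
  rewrite /q; case: asboolP => [ok|_]; first exact: sum_draw_prob.
  by rewrite (bigD1 j0) //= eqxx big1 ?addr0 // => j /negPf ->.
have [P [D [mD law]]] := exists_process q_ge0 q_sum1.
exists P, D; apply: urn_law_process => // n h j; rewrite [LHS]law.
have [->|Ph] := eqVneq (P (past D n @^-1` [set h])) 0%E; first by rewrite !mule0.
rewrite /q asboolT //; apply: (reachable_ok okx _ law Ph) => k i ok.
by rewrite /q asboolT.
Qed.

Hypothesis Mlin : linear_urn R M.

Definition mean_step (x : 'rV[int]_r) : 'rV[R]_r :=
  \sum_(j : sample s r m) p x j *: map_mx intr (x + M j).

Lemma mean_step_linear (t : int) : admissible_total s m t ->
  exists C : 'M[R]_r, forall x, initial_composition x -> num_balls x = t ->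
  mean_step x = map_mx intr x *m C.
Proof.
move=> adm; have [C lin] := Mlin adm; exists (C 1%N) => x x_ge0 xt.
have okx : composition_ok s m x by split; rewrite ?xt.
have [P [D urn]] := exists_urn okx; apply/rowP => i.
have [mD _] := urn.
(* No draw precedes the first step: integrating the linearity identity over the whole space yields
   unconditional means. *)
have hT : history D 0 setT by apply/historyP; exists setT; rewrite preimage_setT.
have [_ _ _ /(_ setT hT)] := lin x x_ge0 xt _ _ P D urn 1%N isT i.
rewrite /= integral_cst // [X in (_ * X)%E](probability_setT P) mule1.
rewrite (integral_finite_valued P (mD 0%N) (fun j => ((x + M j) 0 i)%:~R)).
have PD j : P (D 0%N @^-1` [set j]) = (p x j)%:E.
  have past0 : past D 0 @^-1` [set [tuple]] = setT.
    by apply/seteqP; split.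
  have := urn_process_law mD urn [tuple] j.
  by rewrite past_cons past0 setIT probability_setT mule1.
under eq_bigr do rewrite PD -EFinM.
rewrite sumEFin => -[->]; rewrite summxE; apply: eq_bigr => j _.
by rewrite !mxE mulrC.
Qed.

(* Linearity at the single total [num_balls x] is tested on the urn whose balls
   all have color i: its sample is monochromatic with probability 1. *)
Lemma mean_stepE (x : 'rV[int]_r) : composition_ok s m x ->
  mean_step x =
  map_mx intr x *m (1%:M + ((num_balls x)%:~R)^-1 *: reduced_matrix R M).
Proof.
move=> [x_ge0 adm]; have [C CE] := mean_step_linear adm; rewrite CE //.
congr (_ *m _); apply/matrixP => i l.
set t := num_balls x in adm CE *.
(* Without replacement, T >= m >= 1. *)
have t_neq0 : t%:~R != 0 :> R.
  rewrite intr_eq0 gt_eqF //; move: adm; rewrite /admissible_total.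
  by case: with_replacement; apply: lt_le_trans.
pose y : 'rV[int]_r := t *: delta_mx 0 i; pose j0 := mono_sample s m i.
have [y_ge0 _] := composition_ok_mono i adm.
have py0 : p y j0 = 1 by exact: draw_prob_mono.
(* The probabilities are nonnegative with sum 1, and [j0] already takes all of it. *)
have pyj j : j != j0 -> p y j = 0.
  have : \sum_(j | j != j0) p y j = 0.
    have := sum_draw_prob R (composition_ok_mono i adm).
    rewrite (bigD1 j0) //= py0 => /(canRL (addKr _)) ->.
    by rewrite addNr.
  by move=> /psumr_eq0P; apply=> k _; apply: draw_prob_ge0.
have /rowP/(_ l) := CE y y_ge0 (num_balls_mono t i).
rewrite /mean_step (bigD1 j0) //= big1 => [|j /pyj ->]; last by rewrite scale0r.
rewrite addr0 py0 scale1r.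
have -> : map_mx intr y = t%:~R *: delta_mx 0 i :> 'rV[R]_r.
  by apply/rowP => k; rewrite !mxE rmorphM /= rmorph_nat.
rewrite -scalemxAl -rowE !mxE eqxx => CilE.
apply: (mulfI t_neq0); rewrite -CilE mulrDr mulrA divff // mul1r.
by rewrite rmorphD rmorphM rmorph_nat [l == i]eq_sym.
Qed.

Variables (X0 : 'rV[int]_r) (ok0 : composition_ok s m X0).
Context d (Omega : measurableType d) (P : probability Omega R).
Variable D : nat -> Omega -> sample s r m.
Hypothesis Durn : urn_process M X0 P D.

Lemma num_balls_after h :
  num_balls (composition_after M X0 h) = (size h)%:Z * sigma + num_balls X0.
Proof.
have [_ bal] := Mbal; elim: h => [|j h IHh] /=; first by rewrite mul0r add0r.
by rewrite num_ballsD bal IHh -addn1 PoszD mulrDl mul1r addrAC.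
Qed.

Lemma urn_mean n i :
  ('E_P[fun w => (composition M X0 D n w 0 i)%:~R] =
   ((map_mx intr X0 *m
     \prod_(j < n) (1%:M + (urn_total R sigma (num_balls X0) j)^-1 *:
                      reduced_matrix R M)) 0 i)%:E)%E.
Proof.
have [mD _] := Durn; have law := urn_process_law mD Durn.
have mpast k (h : k.-tuple _) : measurable (past D k @^-1` [set h]).
  by apply: measurable_past => l j _.
pose w k (h : k.-tuple (sample s r m)) := fine (P (past D k @^-1` [set h])).
have wE k (h : k.-tuple _) : P (past D k @^-1` [set h]) = (w k h)%:E.
  by rewrite fineK // fin_num_measure.
have wS k (h : k.-tuple _) j :
    w k.+1 (cons_tuple j h) = p (composition_after M X0 h) j * w k h.
  by apply: EFin_inj; rewrite -wE law wE EFinM.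
(* The mean as a sum over histories, so that the induction deals with finite sums only. *)
pose mu k : 'rV[R]_r :=
  \sum_(h : k.-tuple _) w k h *: map_mx intr (composition_after M X0 h).
suff <- : mu n = map_mx intr X0 *m
    \prod_(j < n) (1%:M + (urn_total R sigma (num_balls X0) j)^-1 *:
                     reduced_matrix R M).
  rewrite unlock; under eq_integral do rewrite composition_past.
  rewrite (integral_finite_valued P (mpast n)
    (fun h : n.-tuple _ => (composition_after M X0 h 0 i)%:~R)).
  rewrite summxE -sumEFin; apply: eq_bigr => h _.
  by rewrite wE -EFinM !mxE mulrC.
elim: n {i} => [|n IHn].
  rewrite big_ord0 mulmx1 /mu (big_pred1 [tuple]) => [|h]; last first.
    exact/esym/eqP/tuple0.
  rewrite /w (_ : _ @^-1` _ = setT) ?probability_setT ?scale1r //.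
  by apply/seteqP; split=> // v _ /=; rewrite [RHS]tuple0.
(* Histories of length n + 1 are grouped by their first n draws h; the inner sum over the last draw
   is a one-step mean. *)
rewrite big_ord_recr /= mulmxA -IHn /mu big_tuple_cons exchange_big /=.
rewrite mulmx_suml; apply: eq_bigr => h _.
(* [mean_stepE] requires an admissible composition, which is known only for h of nonzero
   probability; the other terms vanish on both sides. *)
rewrite -scalemxAl; have [w0|wh] := eqVneq (w n h) 0.
  by rewrite w0 scale0r big1 // => j _; rewrite wS w0 mulr0 scale0r.
(* By balance the total does not depend on h, so one matrix serves all histories. *)
have -> : urn_total R sigma (num_balls X0) n =
    (num_balls (composition_after M X0 h))%:~R.
  by rewrite num_balls_after size_tuple.
rewrite -mean_stepE; last first.
  apply: (reachable_ok ok0 _ law); first by [].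
  by rewrite wE.
rewrite scaler_sumr; apply: eq_bigr => j _.
by rewrite wS scalerA mulrC.
Qed.

End LinearUrn.

Theorem proposition1 (R : realType) (s : scheme) (r m : nat)
    (hr : (2 <= r)%N) (hm : (1 <= m)%N)
    (M : sample s r m -> 'rV[int]_r) (sigma : int)
    (Mbalanced : balanced M sigma) (Mtenable : tenable M)
    (Mlinear : linear_urn R M)
    (X0 : 'rV[int]_r) (X0_ge0 : initial_composition X0)
    (X0_adm : admissible_total s m (num_balls X0))
    (d : measure_display) (Omega : measurableType d) (P : probability Omega R)
    (D : nat -> Omega -> sample s r m) (Durn : urn_process M X0 P D) (n : nat) :
  \row_(i < r) 'E_P[fun w => (composition M X0 D n w 0 i)%:~R]%E =
  map_mx EFin
    (map_mx intr X0 *m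
     \prod_(j < n) (1%:M + (urn_total R sigma (num_balls X0) j)^-1 *:
                           reduced_matrix R M)) :> 'rV[\bar R]_r.
Proof.
apply/rowP => i; rewrite mxE [RHS]mxE.
exact: (urn_mean (ltnW hr) hm Mbalanced Mtenable Mlinear (conj X0_ge0 X0_adm)).
Qed.
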